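(* Let $G$ be a finite soluble group with $|\pi(G)|\ge 2$ and put $k=|\pi(G)|-1$. Then the following statements are equivalent. (1) $G$ is a quasi-$k$-primary group. (2) Every normal subgroup of $G$ is a Hall subgroup of $G$. (3) Every maximal subgroup of $G$ is a Hall subgroup of $G$. (4) $G=[N]M$ (semidirect product with normal factor $N$), where $N$ is a minimal normal subgroup of $G$ and also a Sylow subgroup of $G$, and $M$ is a maximal subgroup of $G$ which is a quasi-$(k-1)$-primary group.
   Context: All groups are finite. For a group $X$, $\pi(X)$ denotes the set of all prime divisors of $|X|$. For an integer $m$, a group $X$ is called quasi-$m$-primary if $|\pi(X)|>m$ and $|\pi(Y)|\le m$ for every maximal subgroup $Y$ of $X$. (For example, a quasi-$0$-primary group is a group of prime order.) A Hall subgroup is a subgroup whose order and index are coprime. $G=[N]M$ means that $N$ is normal in $G$, $G=NM$ and $N\cap M=1$. *)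

(* Defs.v *)
From mathcomp Require Export all_boot all_fingroup all_solvable.

Set Implicit Arguments.
Unset Strict Implicit.
Unset Printing Implicit Defensive.

(* \pi(A) is a predicate on the infinite type nat, so its cardinality is taken
   on the duplicate-free list enumerating it. *)
Definition card_pi (gT : finGroupType) (A : {set gT}) : nat :=
  size (primes #|A|).

(* A negative m is left out: only the trivial group would be quasi-m-primary. *)
Definition quasi_primary (gT : finGroupType) (m : nat) (X : {set gT}) : Prop :=
  (m < card_pi X) /\
  (forall Y : {group gT}, maximal Y X -> card_pi Y <= m).

Arguments card_pi {gT} A%_g.
Arguments quasi_primary {gT} m%_N X%_g.

(* Main.v *)
Require Import Defs.
From mathcomp Require Import zify.

(** A maximal subgroup of a soluble group has prime power index.  Under (1) or
    (3) a maximal subgroup containing a Hall [p^']-subgroup must therefore be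
    that Hall subgroup.  A normal subgroup [H] with [p] dividing [#|H|] is not
    contained in it, so it supplements it and has [p^']-index: this gives (2),
    and, for [H] a minimal normal [p]-subgroup, the decomposition (4).
    Conversely, if [K / N] is a chief factor above the core [N] of a maximal
    subgroup [M], then [#|G : M| = #|K : N|].  As [K] and [N] are Hall
    subgroups under (2), a prime dividing [#|K : N|] divides neither [#|G : K|]
    nor [#|N|], hence not [#|M| = #|G : K| * #|N|].  Under (4), a maximal
    subgroup [Y] either contains [N], and is then determined by its proper
    intersection with [M], or is a complement of the Sylow subgroup [N]
    and so misses its prime. *)

Set Implicit Arguments.
Unset Strict Implicit.

Import GroupScope.

Section Soluble.

Variable gT : finGroupType.
Implicit Types (G H K M N Y : {group gT}) (p q : nat).

(** The primes of [H] are among those of [G], so a smaller count means a missing prime. This turns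
    quasi-primarity into a statement about single primes. *)
Lemma card_pi_ltP H G : H \subset G ->
  reflect (exists2 q, q \in \pi(#|G|) & q \notin \pi(#|H|))
          (card_pi H < card_pi G).
Proof.
move=> sHG.
have sub_pi: {subset primes #|H| <= primes #|G|}.
  by move=> q; apply: (piSg sHG).
apply: (iffP idP) => [ltHG | [q qG qH]].
  case: (altP (@allP _ [in primes #|H|] (primes #|G|))) => [sGH | ].
    by rewrite ltnNge (uniq_leq_size (primes_uniq _) sGH) in ltHG.
  by case/allPn=> q qG qH; exists q.
have uqH: uniq (q :: primes #|H|) by rewrite /= primes_uniq andbT.
apply: uniq_leq_size uqH _ => r; rewrite inE => /predU1P[-> // | ].
exact: sub_pi.
Qed.

Lemma card_pi_pgroup_mul p N M G :
  p.-group N -> #|G| %| #|N| * #|M| -> card_pi G <= (card_pi M).+1.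
Proof.
move=> pN dvG; apply: (@uniq_leq_size _ _ (p :: primes #|M|)) (primes_uniq _) _.
move=> q; rewrite inE mem_primes => /and3P[q_pr _ qG].
have:= dvdn_trans qG dvG; rewrite Euclid_dvdM // => /orP[qN | qM].
  by rewrite (eqP (pnatP _ (cardG_gt0 N) pN q q_pr qN : q == p)) eqxx.
by rewrite mem_primes q_pr cardG_gt0 qM orbT.
Qed.

Lemma Hall_pi'_index G H p : Hall G H -> p \in \pi(#|H|) -> ~~ (p %| #|G : H|).
Proof.
case/andP=> _ coH; rewrite mem_primes => /and3P[p_pr _ pH].
by rewrite -prime_coprime // (coprime_dvdl pH).
Qed.

(** * Maximal subgroups of prime power index and the primes they lose *)

Lemma solvable_maximal_pi_index G p : solvable G -> p \in \pi(#|G|) ->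
  exists2 M : {group gT}, maximal M G & p.-nat #|G : M|.
Proof.
move=> solG pG; have p_pr: prime p by move: pG; rewrite mem_primes => /andP[].
have [H hallH] := Hall_exists p^' solG.
have [sHG p'H pH] := and3P hallH; rewrite pnatNK in pH.
case: (maximal_exists sHG) => [defH | [M maxM sHM]].
  move: p'H pG; rewrite /pgroup defH p'natE // mem_primes => /negPf->.
  by rewrite !andbF.
by exists M => //; apply: pnat_dvd pH; apply: indexgS.
Qed.

(** A prime [q] of [G] that [M] misses divides the index, a power of [p]; hence [q = p]. *)
Lemma pnat_index_p'group G M p q : M \subset G -> p.-nat #|G : M| ->
  q \in \pi(#|G|) -> q \notin \pi(#|M|) -> p^'.-group M.
Proof.
move=> sMG pGM; rewrite !mem_primes => /and3P[q_pr _ qG].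
rewrite q_pr cardG_gt0 /= => q'M.
move: qG; rewrite -(Lagrange sMG) Euclid_dvdM // (negPf q'M) /= => qGM.
by rewrite /pgroup -(eqP (pnatP _ (indexg_gt0 _ _) pGM q q_pr qGM)) p'natE.
Qed.

(** Common consequence of (1) and (3): (1) yields it by counting primes, (3) because a prime
    dividing the index of a proper Hall subgroup cannot divide its order. Both (2) and (4) are
    derived from it. *)
Definition maximal_drops_prime G :=
  forall M, maximal M G -> exists2 q, q \in \pi(#|G|) & q \notin \pi(#|M|).

Lemma Hall_drops_prime G H : Hall G H -> H \proper G ->
  exists2 q, q \in \pi(#|G|) & q \notin \pi(#|H|).
Proof.
case/andP=> sHG coH prH.
have iGH: 1 < #|G : H| by rewrite indexg_gt1 proper_subn.
have q_dv := pdiv_dvd #|G : H|; have q_pr := pdiv_prime iGH.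
exists (pdiv #|G : H|).
  by rewrite mem_primes q_pr cardG_gt0 (dvdn_trans q_dv) ?dvdn_indexg.
apply/negP=> qH; have hH: Hall G H by rewrite /Hall sHG.
by case/negP: (Hall_pi'_index hH qH).
Qed.

Lemma drops_prime_p'_maximal G p :
    solvable G -> maximal_drops_prime G -> p \in \pi(#|G|) ->
  exists2 M : {group gT}, maximal M G & p^'.-Hall(G) M.
Proof.
move=> solG dropG pG.
have [M maxM pGM] := solvable_maximal_pi_index solG pG.
have sMG := maxgroupp maxM; have [q qG qM] := dropG M maxM.
exists M; rewrite // /pHall (proper_sub sMG) pnatNK pGM andbT /=.
exact: pnat_index_p'group (proper_sub sMG) pGM qG qM.
Qed.

Lemma normal_maximal_mul G H M :
  H <| G -> maximal M G -> ~~ (H \subset M) -> H * M = G.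
Proof.
move=> /andP[sHG nHG] /maxgroupP[/proper_sub sMG maxM] not_sHM.
rewrite -norm_joinEr ?(subset_trans sMG) //.
apply: contraNeq not_sHM => neq_G.
rewrite -(maxM (H <*> M)%G) ?joing_subr ?joing_subl //.
by rewrite properEneq neq_G join_subG sHG.
Qed.

Lemma p'maximal_mul G H M p : H <| G -> p \in \pi(#|H|) ->
  maximal M G -> p^'.-group M -> H * M = G.
Proof.
move=> nsHG pH maxM p'M; apply: normal_maximal_mul => //.
apply: contraL pH => sHM; rewrite mem_primes; apply/and3P=> -[p_pr _ pH].
by move: (pgroupS sHM p'M); rewrite /pgroup p'natE // pH.
Qed.

Lemma drops_prime_normal_Hall G H :
  solvable G -> maximal_drops_prime G -> H <| G -> Hall G H.
Proof.
move=> solG dropG nsHG; rewrite /Hall normal_sub //=.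
rewrite coprime_pi' ?cardG_gt0 //.
apply/pnatP=> // p p_pr p_dv; apply/negP=> pH.
have pG := piSg (normal_sub nsHG) pH.
have [M maxM /and3P[_ p'M _]] := drops_prime_p'_maximal solG dropG pG.
have defG := p'maximal_mul nsHG pH maxM p'M.
(* As [G = H * M], the index of [H] in [G] is that of [H :&: M] in [M]. *)
have: #|G : H| %| #|M| by rewrite -defG indexMg -indexgI dvdn_indexg.
by move=> dvM; move: p'M; rewrite /pgroup p'natE // (dvdn_trans p_dv dvM).
Qed.

(** * From normal Hall subgroups to maximal Hall subgroups *)

Lemma solvable_chief_above G N : solvable G -> N <| G -> N \proper G ->
  exists K : {group gT}, [/\ K <| G, N \proper K & abelian (K / N)].
Proof.
move=> solG nsNG prN.
have ntGN: (G / N)%G != 1%G :> {set _}.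
  by rewrite -subG1 quotient_sub1 ?normal_norm // proper_subn.
(* [K] will be the preimage of a minimal normal subgroup of [G / N], abelian by solubility. *)
have [Kb minK sKG] := minnormal_exists ntGN (normG _).
have [nKG ntK abK] := minnormal_solvable minK sKG (quotient_sol N solG).
have nsKG: Kb <| G / N by apply/andP.
have [K defK sNK nsKG'] := inv_quotientN nsNG nsKG.
exists K; rewrite -defK; split=> //; last first.
  by case/is_abelemP: abK => p _ /abelem_abelian.
rewrite properEneq sNK andbT; apply: contraNneq ntK => eqNK.
by rewrite defK -eqNK trivg_quotient.
Qed.

Lemma normal_Hall_maximal_Hall G M : solvable G ->
  (forall H, H <| G -> Hall G H) -> maximal M G -> Hall G M.
Proof.
move=> solG hallG maxM; have prMG := maxgroupp maxM.
have sMG := proper_sub prMG; pose N := gcore_group M G.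
have nsNG: N <| G := gcore_normal sMG.
have sNM: N \subset M := gcore_sub M G.
have [K [nsKG prNK abK]] :=
  solvable_chief_above solG nsNG (sub_proper_trans sNM prMG).
have sKG := normal_sub nsKG; have sNK := proper_sub prNK.
(* The core [N] contains every normal subgroup of [G] inside [M], but not [K]. *)
have not_sKM: ~~ (K \subset M).
  apply: contra (proper_subn prNK) => sKM.
  by rewrite gcore_max ?normal_norm.
have defG := normal_maximal_mul nsKG maxM not_sKM.
have nNK: K \subset 'N(N) := subset_trans sKG (normal_norm nsNG).
(* [K / N] is abelian, so [K :&: M] is normalised by [K] as well as by [M]. *)
have nKM: G \subset 'N(K :&: M).
  rewrite -defG mul_subG //; last first.
    by rewrite normsI ?normG // (subset_trans sMG) ?normal_norm.
  rewrite -commg_subl (subset_trans _ (_ : N \subset _)) //; last first.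
    by rewrite subsetI sNK.
  rewrite -quotient_cents2 //; last by rewrite subIset ?nNK.
  by rewrite (subset_trans (quotientS _ (subsetIl _ _))).
have defN: K :&: M = N.
  apply/eqP; rewrite eqEsubset subsetI sNK sNM !andbT.
  by rewrite gcore_max ?subsetIr.
(* [G = K * M] and [K :&: M = N] give both [#|G : M| = #|K : N|] and [#|G : K| = #|M : N|]. *)
have iGM: #|G : M| = #|K : N|.
  by rewrite -defN indexgI -defG -normC ?indexMg //
    (subset_trans sMG) ?normal_norm.
have cardM: (#|G : K| * #|N|)%N = #|M|.
  by rewrite -defG indexMg -indexgI setIC defN mulnC Lagrange.
have p'idx q : q \in \pi(#|K : N|) -> ~~ (q %| #|M|).
  move=> qKN; have: q \in \pi(#|K|).
    by rewrite (pi_of_dvd (dvdn_indexg K N)).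
  move=> /(Hall_pi'_index (hallG K nsKG)) q'GK.
  have qGN: q %| #|G : N|.
    have: q %| #|K : N| by move: qKN; rewrite mem_primes => /and3P[].
    by move/dvdn_trans; apply; apply: indexSg.
  rewrite -cardM Euclid_dvdM; last by move: qKN; rewrite mem_primes => /andP[].
  rewrite (negPf q'GK) /=; apply/negP=> qN.
  move: qKN; rewrite mem_primes => /andP[q_pr _].
  have qNin: q \in \pi(#|N|) by rewrite mem_primes q_pr cardG_gt0.
  by case/negP: (Hall_pi'_index (hallG N nsNG) qNin).
rewrite /Hall sMG iGM coprime_sym coprime_pi' ?cardG_gt0 //.
apply/pnatP=> // q q_pr qM; apply/negP=> /p'idx.
by rewrite qM.
Qed.

(** * Splitting off a minimal normal Sylow subgroup *)

Lemma drops_prime_sdprod G : solvable G -> 1 < card_pi G ->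
    maximal_drops_prime G ->
  exists N M : {group gT},
    [/\ N ><| M = G, minnormal N G, Sylow G N, maximal M G
      & quasi_primary (card_pi G - 1 - 1) M].
Proof.
move=> solG piG dropG.
have ntG: G != 1%G :> {set gT}.
  by apply: contraTneq piG => defG; rewrite /card_pi defG cards1.
have [N minN sNG] := minnormal_exists ntG (normG G).
have [nNG ntN /is_abelemP[p p_pr /abelem_pgroup pN]] :=
  minnormal_solvable minN sNG solG.
have nsNG: N <| G by apply/andP.
have pNin: p \in \pi(#|N|).
  by have [_ pdvN _] := pgroup_pdiv pN ntN; rewrite mem_primes p_pr cardG_gt0.
have pGin := piSg sNG pNin.
have [M maxM hallM] := drops_prime_p'_maximal solG dropG pGin.
have [sMG p'M _] := and3P hallM.
have tiNM: N :&: M = 1 := coprime_TIg (pnat_coprime pN p'M).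
have defNM := p'maximal_mul nsNG pNin maxM p'M.
have defG: N ><| M = G by rewrite sdprodE // (subset_trans sMG).
have cardG := sdprod_card defG.
exists N, M; split=> //.
  by rewrite /Sylow (pgroup_p pN) drops_prime_normal_Hall.
have piM: card_pi M < card_pi G.
  by apply/(card_pi_ltP sMG); exists p; rewrite // -p'natEpi.
split=> [|Y maxY].
  (* [N] accounts for at most one prime; by [piG] the subtraction [card_pi G - 1 - 1] is not
     truncated. *)
  have dvG: #|G| %| #|N| * #|M| by rewrite cardG.
  by move: (card_pi_pgroup_mul pN dvG) piG; clear; lia.
suffices: card_pi Y < card_pi M by move: piM; clear; lia.
have sYM := proper_sub (maxgroupp maxY).
have nNY: Y \subset 'N(N) by rewrite (subset_trans sYM) ?(subset_trans sMG).
(* A maximal subgroup [L] of [G] above [N <*> Y] loses a prime [q]. As [N] lies in [L], [q] is not a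
   prime of [N], so it is a prime of [M], and [Y] misses it. *)
have prNY: N <*> Y \proper G.
  rewrite properEcard join_subG sNG (subset_trans sYM) //= norm_joinEr //.
  rewrite TI_cardMg; last by apply/trivgP; rewrite -tiNM setIS.
  by rewrite -cardG ltn_pmul2l ?cardG_gt0 // proper_card // (maxgroupp maxY).
have [defNY | [L maxL sNYL]] := maximal_exists (proper_sub prNY).
  by rewrite defNY properxx in prNY.
have [q qG q'L] := dropG L maxL.
move: sNYL; rewrite join_subG => /andP[sNL sYL].
apply/(card_pi_ltP sYM); exists q; last by apply: contra q'L; apply: piSg.
have: q \notin \pi(#|N|) by apply: contra q'L; apply: piSg.
by move: qG; rewrite -cardG pi_ofM ?cardG_gt0 // inE /= => /orP[-> | ].
Qed.

Lemma sdprod_quasi_primary G N M : solvable G -> 1 < card_pi G ->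
    N ><| M = G -> minnormal N G -> Sylow G N ->
    quasi_primary (card_pi G - 1 - 1) M ->
  quasi_primary (card_pi G - 1) G.
Proof.
move=> solG piG defG minN /SylowP[p p_pr sylN] [_ piM].
have [sNG pN _] := and3P sylN.
have [_ ntN /is_abelemP[r _ /abelem_abelian abN]] :=
  minnormal_solvable minN sNG solG.
have [nsNG sMG defNM nNM tiNM] := sdprod_context defG.
have cardG := sdprod_card defG.
have pNin: p \in \pi(#|N|).
  by have [_ pdvN _] := pgroup_pdiv pN ntN; rewrite mem_primes p_pr cardG_gt0.
split=> [|Y maxY]; first by move: piG; clear; lia.
have sYG := proper_sub (maxgroupp maxY).
have [sNY | not_sNY] := boolP (N \subset Y).
  (* Dedekind's law: [Y] has at most one prime more than [M :&: Y], which lies in a maximal subgroup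
     of [M]. *)
  have defY: N * (M :&: Y) = Y by rewrite group_modl // defNM; apply/setIidPr.
  have prYM: M :&: Y \proper M.
    rewrite properEneq subsetIl andbT.
    apply: contraTneq (maxgroupp maxY) => eqM.
    by rewrite -defY eqM defNM properxx.
  have dvY: #|Y| %| #|N| * #|M :&: Y| by rewrite -{1}defY mul_cardG dvdn_mulr.
  have leY := card_pi_pgroup_mul pN dvY.
  have [defMY | [L maxL sYL]] := maximal_exists (proper_sub prYM).
    by rewrite defMY properxx in prYM.
  have leL: card_pi (M :&: Y) <= card_pi L.
    by apply: uniq_leq_size (primes_uniq _) _ => q; apply: (piSg sYL).
  apply: leq_trans leY _; apply: leq_ltn_trans leL _.
  by move: (piM L maxL) piG; clear; lia.
have defNY := normal_maximal_mul nsNG maxY not_sNY.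
(* [N] is abelian, so [N :&: Y] is normal in [N * Y = G]. *)
have nNY: G \subset 'N(N :&: Y).
  rewrite -defNY mul_subG //; last first.
    by rewrite normsI ?normG // (subset_trans sYG) ?normal_norm.
  by rewrite sub_abelian_norm ?subsetIl.
(* If nontrivial, [N :&: Y] would equal [N] by minimality, and [N] would lie in [Y]. *)
have tiNY: N :&: Y = 1.
  apply: contraNeq not_sNY => ntNY; apply/setIidPl.
  have [_ minN'] := mingroupP minN.
  by apply: (minN' (N :&: Y)%G); rewrite ?subsetIl ?ntNY.
suffices: card_pi Y < card_pi G by move: piG; clear; lia.
apply/(card_pi_ltP sYG); exists p; first exact: piSg pNin.
have cardY: #|Y| = #|G : N|.
  by rewrite -defNY indexMg -indexgI setIC tiNY indexg1.
by have [_ _] := and3P sylN; rewrite -cardY p'natEpi.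
Qed.

End Soluble.

Theorem theorem1 (gT : finGroupType) (G : {group gT})
    (solG : solvable G) (piG : 2 <= card_pi G) :
  let k := card_pi G - 1 in
  [<-> quasi_primary k G;
       forall H : {group gT}, (H <| G)%g -> Hall G H;
       forall H : {group gT}, maximal H G -> Hall G H;
       exists N M : {group gT},
         [/\ (N ><| M)%g = G,
             minnormal N G,
             Sylow G N,
             maximal M G
           & quasi_primary (k - 1) M]].
Proof.
move=> k; tfae.
- case=> _ piY H nsHG; apply: drops_prime_normal_Hall => // M maxM.
  apply/card_pi_ltP; first exact: proper_sub (maxgroupp maxM).
  (* Since [card_pi G] is positive, [k.+1 = card_pi G]. *)
  by have := piY M maxM; rewrite -ltnS /k subn1 prednK // ltnW.
- by move=> hallG H; apply: normal_Hall_maximal_Hall.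
- move=> hallG; apply: drops_prime_sdprod => // M maxM.
  exact: Hall_drops_prime (hallG M maxM) (maxgroupp maxM).
- case=> N [M [defG minN sylN _ qM]].
  exact: sdprod_quasi_primary defG minN sylN qM.
Qed.
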